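(* Let $(M^n,f)$ be a homothetical hypersurface in $\mathbb{R}^{n+1}$, that is, the graph of $f(x_1,\dots,x_n)=f_1(x_1)\times\dots\times f_n(x_n)$, where the components $f_1,\dots,f_n$ are real valued functions of class $C^\infty$ with non-vanishing first derivatives. Then $(M^n,f)$ has null Gauss-Kronecker curvature if and only if it is parametrized by one of the following: (a) $\varphi(\mathbf{x})=\left(x_1,\dots,x_n,\ f_1(x_1)\times\gamma e^{\lambda_2x_2+\lambda_3x_3}\times\dots\times f_n(x_n)\right)$ for nonzero constants $\gamma,\lambda_2,\lambda_3$; (b) $\varphi(\mathbf{x})=\left(x_1,\dots,x_n,\ \gamma(x_1+\beta_1)^{\alpha_1}\times\dots\times(x_n+\beta_n)^{\alpha_n}\right)$, where $\beta_1,\dots,\beta_n$ are some constants and $\gamma,\alpha_1,\dots,\alpha_n$ are nonzero constants such that $\sum_{i=1}^n\alpha_i=1$.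
   Context: A hypersurface $M^n$ of the Euclidean space $\mathbb{R}^{n+1}$ is called a homothetical hypersurface, denoted $(M^n,f)$, if it is the graph $\varphi(\mathbf{x})=(x_1,\dots,x_n,f(\mathbf{x}))$, $\mathbf{x}=(x_1,\dots,x_n)$, of a function of the form $f(x_1,\dots,x_n)=f_1(x_1)\times\dots\times f_n(x_n)$ with $f_1,\dots,f_n$ of class $C^\infty$; the $f_i$ are called the components of $f$. The Gauss-Kronecker curvature is the determinant of the shape operator; for the graph of $f$ it equals $$G=\frac{\det(\mathcal{H}(f))}{\omega^{n+2}},\qquad \omega=\sqrt{1+\sum_{i=1}^n\left(\frac{\partial f}{\partial x_i}\right)^2},$$ where $\mathcal{H}(f)=(f_{x_ix_j})$ is the Hessian matrix of second-order partial derivatives of $f$. In (a), the factors $f_2(x_2)f_3(x_3)$ of the product are replaced by $\gamma e^{\lambda_2x_2+\lambda_3x_3}$, and the remaining factors $f_1(x_1),f_4(x_4),\dots,f_n(x_n)$ are the components of $f$.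
   Formalization: In (a) the two exponential factors may have any two distinct indices i, j, not just 2, 3 (else e^{x1+x2}f3(x3) is a counterexample); in (b) a non-integer power of a negative base is read as |x+β|^α; the domain is a product of nonempty open intervals. *)

(* Defs.v *)
From HB Require Import structures.
From mathcomp Require Export all_boot all_order all_algebra.
From mathcomp Require Export all_classical all_reals all_analysis.
Export Order.TTheory GRing.Theory Num.Theory.
Export numFieldNormedType.Exports.

Set Implicit Arguments.
Unset Strict Implicit.
Unset Printing Implicit Defensive.

#[global] Open Scope classical_set_scope.
#[global] Open Scope ring_scope.

Section HypersurfaceGraph.
Variables (R : realType) (n : nat).
Implicit Types (f : 'rV[R]_n -> R) (x : 'rV[R]_n).

Definition partial (V : normedModType R) (i : 'I_n) (F : 'rV[R]_n -> V) x : V :=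
  'D_(delta_mx 0 i) F x.

Definition dot m (u v : 'rV[R]_m) : R := (u *m v^T) 0 0.

Definition graph f x : 'rV[R]_(n + 1) := row_mx x (f x)%:M.

Definition omega f x : R := Num.sqrt (1 + \sum_i partial i f x ^+ 2).

Definition unit_normal f x : 'rV[R]_(n + 1) :=
  (omega f x)^-1 *: row_mx (- \row_i partial i f x) 1%:M.

Definition first_form f x : 'M[R]_n :=
  \matrix_(i, j) dot (partial i (graph f) x) (partial j (graph f) x).

Definition second_form f x : 'M[R]_n :=
  \matrix_(i, j) dot (partial j (partial i (graph f)) x) (unit_normal f x).

(* The matrix, in the basis of tangent vectors [partial i (graph f) x], of the
   operator S on the tangent space with <S u, v> = II(u, v); row vectors are
   multiplied on the left. *)
Definition shape_operator f x : 'M[R]_n :=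
  second_form f x *m invmx (first_form f x).

Definition gauss_kronecker f x : R := \det (shape_operator f x).

Definition hessian f x : 'M[R]_n :=
  \matrix_(i, j) partial j (partial i f) x.

Definition homothetical (fs : 'I_n -> R -> R) x : R := \prod_i fs i (x 0 i).

Definition box (J : 'I_n -> set R) : set 'rV[R]_n :=
  [set x | forall i, J i (x 0 i)].

Lemma dotE m (u v : 'rV[R]_m) : dot u v = \sum_i u 0 i * v 0 i.
Proof. by rewrite /dot mxE; apply: eq_bigr => i _; rewrite mxE. Qed.

Lemma dot_row_mx m k (a c : 'rV[R]_m) (b d : 'rV[R]_k) :
  dot (row_mx a b) (row_mx c d) = dot a c + dot b d.
Proof. by rewrite /dot tr_row_mx mul_row_col mxE. Qed.

Lemma derivable_row_mx m k (a : 'rV[R]_n -> 'rV[R]_m) (b : 'rV[R]_n -> 'rV[R]_k)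
    x v :
  derivable a x v -> derivable b x v ->
  derivable (fun y => row_mx (a y) (b y)) x v.
Proof.
move=> /derivable_mxP da /derivable_mxP db; apply/derivable_mxP => i j.
case: (split_ordP j) => l ->.
- by under eq_fun do rewrite row_mxEl; exact: da.
- by under eq_fun do rewrite row_mxEr; exact: db.
Qed.

Lemma derive_row_mx m k (a : 'rV[R]_n -> 'rV[R]_m) (b : 'rV[R]_n -> 'rV[R]_k)
    x v :
  derivable a x v -> derivable b x v ->
  'D_v (fun y => row_mx (a y) (b y)) x = row_mx ('D_v a x) ('D_v b x).
Proof.
move=> da db; rewrite !derive_mx//; last exact: derivable_row_mx.
apply/matrixP => i j; rewrite mxE; case: (split_ordP j) => l ->.
- by rewrite row_mxEl mxE; under eq_fun do rewrite row_mxEl.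
- by rewrite row_mxEr mxE; under eq_fun do rewrite row_mxEr.
Qed.

Lemma derivable_scalar11 f x v :
  derivable f x v -> derivable (fun y => (f y)%:M : 'rV[R]_1) x v.
Proof.
move=> df; apply/derivable_mxP => i j.
by rewrite (ord1 i) (ord1 j); under eq_fun do rewrite mxE.
Qed.

Lemma derive_scalar11 f x v : derivable f x v ->
  'D_v (fun y => (f y)%:M : 'rV[R]_1) x = ('D_v f x)%:M.
Proof.
move=> df; rewrite derive_mx; last exact: derivable_scalar11.
apply/matrixP => i j; rewrite (ord1 i) (ord1 j) !mxE.
by under eq_fun do rewrite mxE.
Qed.

Lemma partial_graph f x i : derivable f x (delta_mx 0 i) ->
  partial i (graph f) x = row_mx (delta_mx 0 i) (partial i f x)%:M.
Proof.
move=> df; rewrite /partial derive_row_mx ?derive_scalar11//.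
- by rewrite derive_id.
- exact: derivable_scalar11.
Qed.

Lemma det_1D_tr_mul (u : 'rV[R]_n) :
  \det (1%:M + u^T *m u) = 1 + dot u u.
Proof.
pose L := block_mx 1%:M u (- u^T) 1%:M : 'M[R]_(1 + n).
have e1 : L *m block_mx 1%:M (- u) 0 1%:M
        = block_mx 1%:M 0 (- u^T) (1%:M + u^T *m u).
  rewrite mulmx_block !mulmx1 !mulmx0 !mul1mx !addr0 addNr.
  by rewrite mulNmx mulmxN opprK addrC.
have e2 : L *m block_mx 1%:M 0 (u^T) 1%:M
        = block_mx (1%:M + u *m u^T) u 0 1%:M.
  rewrite mulmx_block !mulmx1 !mulmx0 !mul1mx !add0r.
  by rewrite addNr.
have := congr1 (@determinant _ _) e1; rewrite det_mulmx det_ublock det_lblock.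
rewrite !det1 !mulr1 !mul1r => <-.
have := congr1 (@determinant _ _) e2; rewrite det_mulmx det_ublock det_lblock.
by rewrite !det1 !mulr1 => ->; rewrite det_mx11 !mxE /dot mxE.
Qed.

Lemma omega_sqr f x : omega f x ^+ 2 = 1 + \sum_i partial i f x ^+ 2.
Proof. by rewrite sqr_sqrtr// addr_ge0// sumr_ge0// => i _; exact: sqr_ge0. Qed.

Lemma omega_gt0 f x : 0 < omega f x.
Proof. by rewrite sqrtr_gt0 ltr_pwDl// sumr_ge0// => i _; exact: sqr_ge0. Qed.

Lemma unit_normal1 f x : dot (unit_normal f x) (unit_normal f x) = 1.
Proof.
have w0 : omega f x != 0 by rewrite gt_eqF// omega_gt0.
rewrite /dot /unit_normal linearZ/= -scalemxAr -scalemxAl scalerA mxE.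
rewrite -/(dot _ _) dot_row_mx !dotE big_ord1 !mxE mulr1 addrC.
under eq_bigr do rewrite !mxE mulrNN -expr2.
by rewrite -omega_sqr -expr2 exprVn mulVf// expf_neq0.
Qed.

Lemma unit_normal_orth f x i : derivable f x (delta_mx 0 i) ->
  dot (partial i (graph f) x) (unit_normal f x) = 0.
Proof.
move=> df; rewrite partial_graph// /dot linearZ/= -scalemxAr mxE -/(dot _ _).
rewrite dot_row_mx !dotE big_ord1 !mxE mulr1 (bigD1 i)//= big1 => [|j ji].
  by rewrite !mxE !eqxx mul1r addr0 addNr mulr0.
by rewrite !mxE (negbTE ji) andbF mul0r.
Qed.

Lemma first_formE f x : (forall i, derivable f x (delta_mx 0 i)) ->
  first_form f x = 1%:M + (\row_i partial i f x)^T *m \row_i partial i f x.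
Proof.
move=> df; apply/matrixP => i j.
rewrite !mxE !partial_graph// dot_row_mx !dotE !big_ord1 !mxE mulr1n.
congr (_ + _); rewrite (bigD1 i)//= big1 => [|k ki].
  by rewrite !mxE !eqxx mul1r addr0.
by rewrite !mxE (negbTE ki) andbF mul0r.
Qed.

Lemma second_formE f x (U : set 'rV[R]_n) :
  open U -> U x -> (forall y i, U y -> derivable f y (delta_mx 0 i)) ->
  (forall i j, derivable (partial i f) x (delta_mx 0 j)) ->
  second_form f x = (omega f x)^-1 *: hessian f x.
Proof.
move=> oU Ux df d2f; apply/matrixP => i j; rewrite !mxE.
have -> : partial j (partial i (graph f)) x
    = row_mx 0 (partial j (partial i f) x)%:M.
  rewrite {1}/partial.
  rewrite (@near_eq_derive _ _ _ _
    (fun y => row_mx (delta_mx 0 i) (partial i f y)%:M)); last first.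
    near=> y; apply: partial_graph; apply: df.
    by near: y; exact: open_nbhs_nbhs.
  rewrite derive_row_mx; [|exact: derivable_cst|exact: derivable_scalar11].
  by rewrite derive_cst derive_scalar11.
rewrite /dot /unit_normal linearZ/= -scalemxAr mxE -/(dot _ _) dot_row_mx.
rewrite !dotE big_ord1 big1 => [|k _]; last by rewrite !mxE mul0r.
by rewrite !mxE !mulr1n mulr1 add0r.
Unshelve. all: by end_near. Qed.

Lemma gauss_kroneckerE f x (U : set 'rV[R]_n) :
  open U -> U x -> (forall y i, U y -> derivable f y (delta_mx 0 i)) ->
  (forall i j, derivable (partial i f) x (delta_mx 0 j)) ->
  gauss_kronecker f x = \det (hessian f x) / omega f x ^+ (n + 2).
Proof.
move=> oU Ux df d2f; rewrite /gauss_kronecker /shape_operator det_mulmx.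
rewrite det_inv (second_formE oU)// first_formE => [|i]; last exact: df.
rewrite det_1D_tr_mul detZ exprVn.
have -> : dot (\row_i partial i f x) (\row_i partial i f x)
    = \sum_i partial i f x ^+ 2.
  by rewrite dotE; apply: eq_bigr => i _; rewrite !mxE expr2.
by rewrite -omega_sqr (exprD _ n 2) [in RHS]invfM mulrA (mulrC _ (\det _)).
Qed.

End HypersurfaceGraph.

Section RealFunctions.
Variable R : realType.

Definition smooth_on (J : set R) (g : R -> R) : Prop :=
  forall (k : nat) (t : R), J t -> derivable (derive1n k g) t 1.

(* The real power with the base of either sign: [t ^ a] whenever that has its
   usual meaning, i.e. for t >= 0 (see [real_powE]) or for an integer a.  For
   t < 0 and a not an integer, t ^ a only makes sense up to a constant factor,
   and this chooses |t| ^ a: the general solution of g' / g = a / t on an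
   interval of negative numbers is c * |t| ^ a.  The library's [powR] cannot be
   used there, as it is 1 at every negative base. *)
Definition real_pow (t a : R) : R :=
  if a \is a Num.int then t ^ Num.floor a else `|t| `^ a.

Lemma real_powE (t a : R) : 0 <= t -> real_pow t a = t `^ a.
Proof.
move=> t0; rewrite /real_pow; case: ifPn => [aZ|_]; last by rewrite ger0_norm.
by rewrite -powR_intmul// floorK.
Qed.

Lemma real_pow_int (t : R) (z : int) : real_pow t z%:~R = t ^ z.
Proof. by rewrite /real_pow intr_int intrKfloor. Qed.

End RealFunctions.

(* Main.v *)
Require Import Defs.
From mathcomp Require Import ring.

(** Write [v_i = f_i'] and [W_i = f_i f_i'' - f_i'^2 = f_i^2 (ln f_i)''].  After
    scaling row [i] by [f_i] and column [j] by [f_j], the Hessian of [f] becomes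
    [f * (diag W + v^T v)], so where [f] does not vanish the curvature is zero iff
    [diag W + v^T v] has a kernel vector.  No [v_i] vanishes, hence this happens
    when two of the [W_i] vanish, never when exactly one does, and, when none
    does, iff [\sum_i v_i^2 / W_i = -1].  Either two of the [W_i] vanish
    identically, which gives two exponential factors, or one varies a single
    coordinate around a point where no [W_i] vanishes: every [v_i^2 / W_i] is then
    a constant [- alpha_i], i.e. [(f_i / f_i')' = 1 / alpha_i], which integrates
    to a power.  Conversely both forms yield a kernel vector of the Hessian, in the
    power case Euler's relation for functions of degree 1. *)

Set Implicit Arguments.
Unset Strict Implicit.
Unset Printing Implicit Defensive.

#[local] Arguments derive1n : simpl never.

(** * One-variable calculus on an interval and the exponential case *)

Section OneVariable.
Variable R : realType.
Implicit Types (J : set R) (g h : R -> R) (a t : R).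

Lemma derive1_eq_on J g h : open J -> (forall t, J t -> g t = h t) ->
  forall t, J t -> derive1 g t = derive1 h t.
Proof.
move=> oJ gh t Jt; rewrite !derive1E; apply: near_eq_derive.
by near=> s; apply: gh; near: s; exact: open_nbhs_nbhs.
Unshelve. all: by end_near. Qed.

Lemma is_derive_derive1 g t : derivable g t 1 -> is_derive t 1 g (derive1 g t).
Proof. by move=> dg; rewrite derive1E; exact: derivableP. Qed.

Lemma is_derive1E g t a : is_derive t 1 g a -> derive1 g t = a.
Proof. by rewrite derive1E => dg; rewrite derive_val. Qed.

(* Off the zeros of [g] this is clear; at a zero, differentiate [g * h = 0]. *)
Lemma mul_eq0_on J g h : open J ->
  (forall t, J t -> derivable g t 1) -> (forall t, J t -> derivable h t 1) ->
  (forall t, J t -> derive1 g t != 0) ->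
  (forall t, J t -> g t * h t = 0) -> forall t, J t -> h t = 0.
Proof.
move=> oJ dg dh g'0 gh t Jt.
have [gt0|gt0] := eqVneq (g t) 0; last first.
  by move: (gh _ Jt) => /eqP; rewrite mulf_eq0 (negbTE gt0) => /eqP.
have := is_derive_derive1 (dg _ Jt); have := is_derive_derive1 (dh _ Jt).
move=> Dh Dg; have /is_derive1E := is_deriveM Dg Dh.
rewrite (@derive1_eq_on J _ (cst 0))//.
rewrite derive1_cst gt0 scale0r add0r.
move=> /esym/eqP; rewrite scaler_eq0 => /orP[/eqP//|].
by rewrite (negbTE (g'0 _ Jt)).
Qed.

(** If [g] vanished throughout [J], then [g * 1 = 0] there, and [mul_eq0_on] would give [1 = 0]. *)
Lemma not_identically_zero J g : open J -> J !=set0 ->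
  (forall t, J t -> derivable g t 1) -> (forall t, J t -> derive1 g t != 0) ->
  exists2 t, J t & g t != 0.
Proof.
move=> oJ [t0 Jt0] dg g'0; apply: contrapT => H.
suff : (cst 1 : R -> R) t0 = 0 by move/eqP; rewrite oner_eq0.
apply: (@mul_eq0_on J g) => // t Jt; rewrite mulr1; apply/eqP.
by apply: contrapT => /negP gt; apply: H; exists t.
Qed.

Lemma cst_on J g : is_interval J -> (forall t, J t -> is_derive t 1 g 0) ->
  forall s t, J s -> J t -> g s = g t.
Proof.
move=> iJ dg.
suff H s t : J s -> J t -> s < t -> g t = g s.
  move=> s t Js Jt; have [st|ts|->//] := ltgtP s t; first exact/esym/H.
  exact: H.
move=> Js Jt st.
have sub x : x \in `[s, t]%R -> J x.
  by rewrite in_itv/= => /andP[sx xt]; apply: (iJ s t) => //; rewrite sx xt.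
have [||c _] := @MVT _ g (cst 0) s t st.
- by move=> x /subset_itv_oo_cc xst; exact/dg/sub.
- by apply: derivable_within_continuous => x /sub /dg [].
by rewrite mul0r => /eqP; rewrite subr_eq0 => /eqP.
Qed.

Lemma smooth_is_derive J g k t : smooth_on J g -> J t ->
  is_derive t 1 (derive1n k g) (derive1n k.+1 g t).
Proof. by move=> sg Jt; exact/is_derive_derive1/sg. Qed.

Lemma is_derive_scale a t : is_derive t 1 (fun x : R => a * x) a.
Proof.
by apply: is_derive_eq (is_deriveZ a (is_derive_id t 1)) _; exact: mulr1.
Qed.

(** The Wronskian of [g] and [g']. Unlike [(ln g)''], it stays meaningful and differentiable at the
    zeros of [g]. *)
Definition log_wronskian g t := g t * derive1n 2 g t - derive1 g t ^+ 2.

Lemma derivable_log_wronskian J g t : smooth_on J g -> J t ->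
  derivable (log_wronskian g) t 1.
Proof.
move=> sg Jt; have d k := sg k t Jt.
rewrite (_ : log_wronskian g = g * derive1n 2 g - derive1n 1 g * derive1n 1 g).
  by apply: derivableB; apply: derivableM; [exact: (d 0)|exact: d..].
by apply/funext => s; rewrite /log_wronskian expr2.
Qed.

(** At a zero of [g] the Wronskian would be [- g'^2], which is nonzero, so [g] has no zero. Then
    [(g' / g)' = 0], so [g' = l g] for a constant [l], and [g(t) exp(- l t)] is constant. *)
Lemma exp_of_log_wronskian_eq0 J g : is_interval J -> J !=set0 ->
  smooth_on J g -> (forall t, J t -> derive1 g t != 0) ->
  (forall t, J t -> log_wronskian g t = 0) ->
  exists c l, [/\ c != 0, l != 0 & forall t, J t -> g t = c * expR (l * t)].
Proof.
move=> iJ [t0 Jt0] sg g'0 W0.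
have g0 t : J t -> g t != 0.
  move=> Jt; apply/eqP => gt0; move: (W0 _ Jt); rewrite /log_wronskian gt0.
  by rewrite mul0r sub0r => /eqP; rewrite oppr_eq0 sqrf_eq0 (negbTE (g'0 _ Jt)).
have Dg t : J t -> is_derive t 1 g (derive1 g t).
  exact: (@smooth_is_derive J g 0).
have Dg' t : J t -> is_derive t 1 (derive1 g) (derive1n 2 g t).
  exact: (@smooth_is_derive J g 1).
pose l := derive1 g t0 / g t0.
have lE t : J t -> derive1 g t = l * g t.
  move=> Jt; suff <- : derive1 g t / g t = l by rewrite divfK ?g0.
  apply: (@cst_on J (derive1 g * (fun x => (g x)^-1)) iJ) => // s Js.
  have Dgs := Dg _ Js; have Dgs' := Dg' _ Js; have gs := g0 _ Js.
  apply: is_derive_eq (is_deriveM Dgs' (is_deriveV gs Dgs)) _.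
  rewrite /GRing.scale/=; have := W0 _ Js; rewrite /log_wronskian => W.
  apply: (mulfI (expf_neq0 2 gs)); rewrite mulr0 -W; field.
  exact: gs.
(* The value at [t0] of the constant function [g(t) exp(- l t)]. *)
exists (g t0 * expR (- l * t0)), l; split.
- by rewrite mulf_neq0 ?g0// gt_eqF ?expR_gt0.
- by rewrite mulf_neq0 ?invr_neq0 ?g0 ?g'0.
move=> t Jt; rewrite -[LHS]mulr1 -expR0 -(subrr (l * t)) -[in LHS]addrC expRD.
rewrite mulrA; congr (_ * _); rewrite -mulNr.
apply: (@cst_on J (g * (fun x => expR (- l * x))) iJ) => // s Js.
have Dgs := Dg _ Js.
have De : is_derive s 1 (fun x => expR (- l * x)) (expR (- l * s) * - l).
  apply: (@is_derive1_comp _ expR (fun x => - l * x)).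
  exact: is_derive_scale.
apply: is_derive_eq (is_deriveM Dgs De) _.
by rewrite /GRing.scale/= lE//; ring.
Qed.

End OneVariable.

(** * Real powers and the differential equations that characterize them *)

Section Powers.
Variable R : realType.
Implicit Types (J : set R) (g : R -> R) (a b c t : R).

(** The sign in front does not depend on [t], so differentiating on the negative half-line reduces
    to [powR] at [- t]. *)
Lemma real_pow_lt0 a t : t < 0 ->
  real_pow t a = (if a \is a Num.int then (-1) ^ Num.floor a else 1) * (- t) `^ a.
Proof.
move=> t0; rewrite /real_pow; case: ifPn => [aZ|_]; last first.
  by rewrite ltr0_norm// mul1r.
rewrite -[in (- t) `^ a](floorK aZ) powR_intmul ?oppr_ge0 1?ltW//.
by rewrite -expfzMl mulN1r opprK.
Qed.

Lemma real_pow_neq0 a t : t != 0 -> real_pow t a != 0.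
Proof.
move=> t0; rewrite /real_pow; case: ifPn => _; first by rewrite expfz_neq0.
by rewrite gt_eqF// powR_gt0// normr_gt0.
Qed.

Lemma real_pow1 t : real_pow t 1 = t.
Proof. exact: (real_pow_int t 1). Qed.

Lemma powR_divx a t : 0 < t -> t `^ (a - 1) = t `^ a / t.
Proof. by move=> t0; rewrite powRB ?powRr1 ?(ltW t0)// (gt_eqF t0) implybT. Qed.

(** Dividing by [t], rather than lowering the exponent, gives one formula for both signs: if [t < 0]
    and [a] is not an integer, then [|t|^a / t = - |t|^(a - 1)]. *)
Lemma is_derive_real_pow a t : t != 0 ->
  is_derive t 1 (fun x => real_pow x a) (a * real_pow t a / t).
Proof.
case: (ltgtP t 0) => // [t0 _|t0 _].
  set k : R := if a \is a Num.int then (-1) ^ Num.floor a else 1.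
  have D : is_derive t 1 (k \*: ((fun x => powR x a) \o -%R))
      (a * real_pow t a / t).
    have Nt0 : 0 < - t by rewrite oppr_gt0.
    have DN : is_derive t 1 (-%R : R -> R) (- 1).
      exact: is_deriveN (is_derive_id t 1).
    apply: is_derive_eq (is_deriveZ k (is_derive1_comp (is_derive1_powR a Nt0) DN)) _.
    rewrite powR_divx// real_pow_lt0// -/k /GRing.scale/=; field.
    by rewrite lt_eqF.
  have [dD eD] := D; split.
    apply: near_eq_derivable dD; near=> s; apply/esym/real_pow_lt0.
    by near: s; exact: lt_nbhsl.
  rewrite -eD; apply: near_eq_derive; near=> s; apply/real_pow_lt0.
  by near: s; exact: lt_nbhsl.
have [dD eD] := is_derive1_powR a t0; split.
  apply: near_eq_derivable dD; near=> s; apply/esym/real_powE/ltW.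
  by near: s; exact: lt_nbhsr.
rewrite real_powE 1?ltW// -mulrA -powR_divx// -eD.
apply: near_eq_derive; near=> s; apply/real_powE/ltW.
by near: s; exact: lt_nbhsr.
Unshelve. all: by end_near. Qed.

Lemma is_derive_real_pow_shift a b t : t + b != 0 ->
  is_derive t 1 (fun x => real_pow (x + b) a) (a * real_pow (t + b) a / (t + b)).
Proof.
move=> tb; rewrite -[X in is_derive _ _ _ X]mulr1.
exact: (@is_derive1_comp _ (fun x => real_pow x a) (shift b) _ _ _
  (is_derive_real_pow a tb) (is_derive_shift t 1 b)).
Qed.

(** The hypothesis says [(g / g')' = 1 / a]. Integrating gives [a g = (t + b) g'], a linear equation
    whose solutions away from [- b] are the multiples of [(t + b)^a]. *)
Lemma power_of_log_wronskian J g a : open J -> is_interval J -> J !=set0 ->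
  smooth_on J g -> (forall t, J t -> derive1 g t != 0) -> a != 0 ->
  (forall t, J t -> a * log_wronskian g t = - derive1 g t ^+ 2) ->
  exists c b, c != 0 /\ forall t, J t -> g t = c * real_pow (t + b) a.
Proof.
move=> oJ iJ [t0 Jt0] sg g'0 a0 aW.
have Dg t : J t -> is_derive t 1 g (derive1 g t).
  exact: (@smooth_is_derive _ J g 0).
have Dg' t : J t -> is_derive t 1 (derive1 g) (derive1n 2 g t).
  exact: (@smooth_is_derive _ J g 1).
(* Solves [a g = (t + b) g'] for [b] at [t = t0]. *)
pose b := a * (g t0 / derive1 g t0) - t0.
have gE t : J t -> a * g t = (t + b) * derive1 g t.
  move=> Jt; pose q := g * (fun x => (derive1 g x)^-1) - (fun x => a^-1 * x).
  have q_cst : q t = q t0.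
    apply: (@cst_on _ J q iJ) => // s Js.
    have Dgs := Dg _ Js; have Dgs' := Dg' _ Js; have g's := g'0 _ Js.
    apply: is_derive_eq (is_deriveB (is_deriveM Dgs (is_deriveV g's Dgs'))
                                    (is_derive_scale a^-1 s)) _.
    rewrite /GRing.scale/=; apply: (mulfI (expf_neq0 2 g's)); apply: (mulfI a0).
    transitivity (- derive1 g s ^+ 2 - a * log_wronskian g s).
      by rewrite /log_wronskian; field; rewrite a0 g's.
    by rewrite aW// subrr !mulr0.
  have : q t * a = q t0 * a by rewrite q_cst.
  rewrite /q /= -![(_ - _ : _ -> _) _]/(_ - _) -![(_ * _ : _ -> _) _]/(_ * _).
  rewrite !mulrBl ![a^-1 * _ * a]mulrAC !mulVf// !mul1r.
  move=> /eqP; rewrite subr_eq => /eqP E.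
  apply: (mulIf (invr_neq0 (g'0 _ Jt))); rewrite mulfK ?g'0// /b -mulrA.
  by rewrite [LHS]mulrC E; ring.
(* [g] vanishes at [- b], which forces [a = 1] and [g] affine. *)
have [Jb|Jb] := pselect (J (- b)).
  have gb : g (- b) = 0.
    by apply/eqP; have /eqP := gE _ Jb; rewrite addNr mul0r mulf_eq0 (negbTE a0).
  have a1 : a = 1.
    have := aW _ Jb; rewrite /log_wronskian gb mul0r sub0r mulrN => /oppr_inj.
    by rewrite -[RHS]mul1r => /(mulIf (expf_neq0 2 (g'0 _ Jb))).
  (* For [a = 1] the hypothesis reduces to [g g'' = 0], and the factor [g] can be removed because
     [g'] never vanishes. *)
  have g''0 : forall t, J t -> derive1n 2 g t = 0.
    apply: (@mul_eq0_on _ J g) => //.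
    - exact: (sg 0).
    - exact: (sg 2).
    - move=> t /aW; rewrite a1 mul1r /log_wronskian => /eqP.
      by rewrite subr_eq addNr => /eqP.
  exists (derive1 g (- b)), b; split; first exact: g'0.
  move=> t Jt; rewrite a1 real_pow1 -[g t]mul1r -a1 gE// mulrC; congr (_ * _).
  apply: (@cst_on _ J _ iJ) => // s Js.
  by have := Dg' _ Js; rewrite g''0.
(* From here on [- b] lies outside [J], so [(t + b)^a] is differentiable and nonzero on [J], and the
   quotient of [g] by it has zero derivative. *)
have tb t : J t -> t + b != 0.
  by move=> Jt; apply/negP; rewrite addr_eq0 => /eqP tb; apply: Jb; rewrite -tb.
pose r x := real_pow (x + b) a.
have r0 t : J t -> r t != 0 by move=> Jt; exact/real_pow_neq0/tb.
have c_eq t : J t -> g t / r t = g t0 / r t0.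
  move=> Jt; apply: (@cst_on _ J (g * (fun x => (r x)^-1)) iJ) => // s Js.
  have Dgs := Dg _ Js; have rs := r0 _ Js; have sb := tb _ Js.
  apply: is_derive_eq (is_deriveM Dgs (is_deriveV rs
                        (is_derive_real_pow_shift a sb))) _.
  rewrite /GRing.scale/= -/(r s).
  apply: (mulIf (mulf_neq0 sb rs)).
  rewrite mul0r -(subrr (a * g s)) [in X in _ = X - _]gE//.
  by field; rewrite rs sb.
have c0 : g t0 / r t0 != 0.
  apply: mulf_neq0; last by rewrite invr_neq0 ?r0.
  apply/eqP => gt0; have /eqP := gE _ Jt0.
  by rewrite gt0 mulr0 eq_sym mulf_eq0 (negbTE (tb _ Jt0)) (negbTE (g'0 _ Jt0)).
exists (g t0 / r t0), b; split => // t Jt.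
by rewrite -(c_eq t)// divfK// r0.
Qed.

(** At [t = - b] the power itself need not be differentiable. The difference of the two sides is
    differentiable because [g] is smooth; its product with [t + b] vanishes everywhere, and
    [mul_eq0_on] removes that factor. *)
Lemma power_derive1 J g a b c : open J -> smooth_on J g ->
  (forall t, J t -> g t = c * real_pow (t + b) a) ->
  forall t, J t -> (t + b) * derive1 g t = a * g t.
Proof.
move=> oJ sg gE t Jt; apply/eqP; rewrite -subr_eq0; apply/eqP.
pose h := shift b * derive1n 1 g - a \*: g.
apply: (@mul_eq0_on _ J (shift b) h) => // {t Jt}.
- move=> t Jt; have Dg := @smooth_is_derive _ J g 0 t sg Jt.
  have Dg' := @smooth_is_derive _ J g 1 t sg Jt.
  have [d _] := is_deriveB (is_deriveM (is_derive_shift t 1 b) Dg')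
                           (is_deriveZ a Dg).
  exact: d.
- by move=> t _; rewrite (is_derive1E (is_derive_shift t 1 b)) oner_eq0.
- move=> t Jt; have [tb|tb] := eqVneq (t + b) 0; first by rewrite [shift b t]tb mul0r.
  have -> : h t = (t + b) * derive1 g t - a * g t by [].
  rewrite (@derive1_eq_on _ J _ (c \*: fun x => real_pow (x + b) a)) ?gE//.
  have := is_deriveZ c (is_derive_real_pow_shift a tb).
  by move=> /is_derive1E ->; rewrite /GRing.scale/=; field.
Qed.

(** Differentiating the hypothesis gives [g' + (t + b) g'' = a g']. *)
Lemma power_derive1n2 J g a b : open J -> smooth_on J g ->
  (forall t, J t -> (t + b) * derive1 g t = a * g t) ->
  forall t, J t -> (t + b) * derive1n 2 g t = (a - 1) * derive1 g t.
Proof.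
move=> oJ sg gE t Jt.
have := is_deriveM (is_derive_shift t 1 b) (@smooth_is_derive _ J g 1 t sg Jt).
move=> /is_derive1E.
rewrite (@derive1_eq_on _ J _ (a \*: g))//.
rewrite (is_derive1E (is_deriveZ a (@smooth_is_derive _ J g 0 t sg Jt))).
rewrite /GRing.scale/= mulr1 -[derive1n 1 g]/(derive1 g) => /eqP.
by rewrite -subr_eq => /eqP <-; rewrite mulrBl mul1r.
Qed.

End Powers.

(** * Partial derivatives and Hessian of a product of one-variable functions *)

Section Hessian.
Variables (R : realType) (n : nat) (J : 'I_n -> set R) (fs : 'I_n -> R -> R).
Hypothesis J_open : forall i, open (J i).
Hypothesis fs_smooth : forall i, smooth_on (J i) (fs i).
Implicit Types (x u : 'rV[R]_n) (i j k : 'I_n).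

Lemma box_open : open (box J).
Proof.
rewrite openE => x Jx; rewrite /interior/=.
suff : nbhs x (fun y : 'rV[R]_n => forall i, J i (y 0 i)) by [].
apply: (filter_forall (nbhs_filter x)) => i.
have /(_ (J i)) := @coord_continuous R 1 n 0 i x; apply.
by apply: open_nbhs_nbhs; split; [exact: (@J_open i)|exact: Jx].
Qed.

(** The mixed partial derivative of the product with multi-index [e]; one more derivative in
    direction [i] just raises [e i] by one. *)
Definition prod_derive1n (e : 'I_n -> nat) x : R :=
  \prod_k derive1n (e k) (fs k) (x 0 k).

(** Along the [i]-th axis only the [i]-th factor moves, so the difference quotient is that of [G i]
    times a constant. *)
Lemma is_derive_prod_coord (G : 'I_n -> R -> R) x i a :
  is_derive (x 0 i) 1 (G i) a ->
  is_derive x (delta_mx 0 i) (fun y : 'rV_n => \prod_k G k (y 0 k))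
    (a * \prod_(k | k != i) G k (x 0 k)).
Proof.
move=> [dG eG]; set K := \prod_(k | k != i) _.
suff H : (fun h => h^-1 *: (((fun y : 'rV_n => \prod_k G k (y 0 k)) \o shift x)
      (h *: delta_mx 0 i) - \prod_k G k (x 0 k))) @ 0^' --> (a * K : R).
  by split; [apply/cvg_ex; exists (a * K)|exact: cvg_lim H].
rewrite [X in X @ _](_ : _ =
    fun h => (h^-1 *: ((G i \o shift (x 0 i)) (h *: 1) - G i (x 0 i))) * K); last first.
  apply/funext => h; rewrite /= [in LHS](bigD1 i)//= [X in _ - X](bigD1 i)//=.
  rewrite !mxE !eqxx -/K (_ : \prod_(k | _) _ = K); last first.
    by apply: eq_bigr => k ki; rewrite !mxE (negbTE ki) andbF mulr0 add0r.
  by rewrite -mulrBl scalerAl.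
by apply: cvgM; [rewrite -eG; exact: dG|exact: cvg_cst].
Qed.

Lemma is_derive_prod_derive1n e x i : box J x ->
  is_derive x (delta_mx 0 i) (prod_derive1n e)
    (prod_derive1n (fun k => (k == i) + e k)%N x).
Proof.
move=> Jx; have := is_derive_prod_coord (G := fun k => derive1n (e k) (fs k))
  (smooth_is_derive (e i) (@fs_smooth i) (Jx i)).
move=> D; apply: is_derive_eq D _; rewrite /prod_derive1n [RHS](bigD1 i)//= eqxx.
by congr (_ * _); apply: eq_bigr => k /negbTE ->.
Qed.

Lemma partial_homothetical x i : box J x ->
  partial i (homothetical fs) x = prod_derive1n (fun k => (k == i) : nat) x.
Proof.
move=> Jx; have [_] := is_derive_prod_derive1n (fun=> 0%N) i Jx.
by rewrite /partial => ->; apply: eq_bigr => k _; rewrite addn0.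
Qed.

Lemma is_derive_partial_homothetical x i j : box J x ->
  is_derive x (delta_mx 0 j) (partial i (homothetical fs))
   (prod_derive1n (fun k => (k == j) + (k == i))%N x).
Proof.
move=> Jx; have [d e] := is_derive_prod_derive1n (fun k => (k == i) : nat) j Jx.
(* The formula for the first partial derivative is known on the box only; to differentiate it again,
   it must hold in a neighbourhood of [x]. *)
have near_box : \forall y \near x, box J y.
  by apply: open_nbhs_nbhs; split => //; exact: box_open.
split.
  apply: near_eq_derivable d; apply: filterS near_box => y Jy.
  by rewrite partial_homothetical.
rewrite -e; apply: near_eq_derive; apply: filterS near_box => y Jy.
by rewrite partial_homothetical.
Qed.

Lemma hessian_homothetical x i j : box J x ->
  hessian (homothetical fs) x i j = prod_derive1n (fun k => (k == j) + (k == i))%N x.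
Proof.
by move=> Jx; rewrite mxE /partial; have [_ ->] := is_derive_partial_homothetical i j Jx.
Qed.

Lemma gauss_kronecker_eq0 x : box J x ->
  gauss_kronecker (homothetical fs) x = 0 <->
  \det (hessian (homothetical fs) x) = 0.
Proof.
move=> Jx; rewrite (gauss_kroneckerE box_open Jx).
- split => [/eqP|->]; last by rewrite mul0r.
  by rewrite mulf_eq0 invr_eq0 expf_eq0 (gt_eqF (omega_gt0 _ _)) andbF orbF => /eqP.
- by move=> y i Jy; have [] := is_derive_prod_derive1n (fun=> 0%N) i Jy.
- by move=> i j; have [] := is_derive_partial_homothetical i j Jx.
Qed.

(** On the diagonal, [W_i + f_i'^2] is [f_i f_i'']; off it, both sides have the same factors.
    Nothing is divided, so zeros of the components are allowed. *)
Lemma hessian_homothetical_scaled x i j : box J x ->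
  fs i (x 0 i) * hessian (homothetical fs) x i j * fs j (x 0 j) =
  homothetical fs x *
  ((if i == j then log_wronskian (fs i) (x 0 i) else 0)
   + derive1 (fs i) (x 0 i) * derive1 (fs j) (x 0 j)).
Proof.
move=> Jx; rewrite hessian_homothetical// /homothetical /prod_derive1n.
have [<-|ij] := eqVneq i j.
  rewrite !(bigD1 i (P := predT))//= !eqxx /log_wronskian.
  rewrite [X in fs i _ * (_ * X)](_ : _ = \prod_(k | k != i) fs k (x 0 k)).
    by rewrite -[derive1n (1 + 1) _]/(derive1n 2 (fs i)); ring.
  by apply: eq_bigr => k /negbTE ->.
have ji : j != i by rewrite eq_sym.
rewrite !(bigD1 i (P := predT))//= !(bigD1 j (P := fun k => k != i))//=.
rewrite !eqxx (negbTE ij) (negbTE ji) /=.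
rewrite [X in fs i _ * (_ * (_ * X))](_ : _ =
    \prod_(k | (k != i) && (k != j)) fs k (x 0 k)).
  rewrite -[derive1n (0 + 1) _]/(derive1 (fs i)).
  by rewrite -[derive1n (1 + 0) _]/(derive1 (fs j)); ring.
by apply: eq_bigr => k /andP[/negbTE -> /negbTE ->].
Qed.

(** If [w] is in the left kernel of the Hessian, dividing each [w_i] by [f_i] undoes the row
    scaling. Multiplying the [j]-th equation by [f_j] then brings in the scaled entries, and the
    common factor [f] cancels. *)
Lemma hessian_kernel x : box J x -> (forall k, fs k (x 0 k) != 0) ->
  \det (hessian (homothetical fs) x) = 0 ->
  exists2 u : 'rV[R]_n, u != 0 & forall j, u 0 j * log_wronskian (fs j) (x 0 j)
    + (\sum_i u 0 i * derive1 (fs i) (x 0 i)) * derive1 (fs j) (x 0 j) = 0.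
Proof.
move=> Jx f0 /eqP/det0P[w w0 wH].
have F0 : homothetical fs x != 0 by apply/prodf_neq0 => k _; exact: f0.
exists (\row_i (w 0 i / fs i (x 0 i))).
  apply: contra w0 => /eqP/rowP w0; apply/eqP/rowP => i.
  by move/eqP: (w0 i); rewrite !mxE mulf_eq0 invr_eq0 (negbTE (f0 i)) orbF => /eqP.
move=> j; apply: (mulfI F0); rewrite mulr0.
have /rowP/(_ j) := wH; rewrite !mxE => /(congr1 (fun z => z * fs j (x 0 j))).
rewrite mul0r => wj; rewrite -[RHS]wj [in RHS]mulr_suml.
transitivity (\sum_i w 0 i / fs i (x 0 i) * (homothetical fs x *
  ((if i == j then log_wronskian (fs i) (x 0 i) else 0)
   + derive1 (fs i) (x 0 i) * derive1 (fs j) (x 0 j)))); last first.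
  apply: eq_bigr => i _; rewrite -hessian_homothetical_scaled// !mulrA.
  by rewrite divfK ?f0.
under [RHS]eq_bigr do rewrite mulrDr mulrDr.
rewrite [RHS]big_split/= [in RHS](bigD1 j)//= eqxx [X in _ = _ + X + _]big1 => [|i /negbTE ->].
  rewrite mulr_suml mulrDr mulr_sumr addr0; congr (_ + _).
    by rewrite ?mxE; ring.
  by apply: eq_bigr => i _; rewrite ?mxE; ring.
by rewrite !mulr0.
Qed.

End Hessian.

(** * Kernel of a diagonal matrix plus a rank-one matrix *)

Section RankOnePerturbation.
Variables (F : fieldType) (n : nat) (d v u : 'I_n -> F).
Hypothesis v_neq0 : forall i, v i != 0.
Hypothesis u_ker : forall j, u j * d j + (\sum_i u i * v i) * v j = 0.

(** Let [s] be the sum of the [u_k v_k]. Equation [i] gives [s = 0]; the other equations then give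
    [u_j = 0] for [j] other than [i], so that [s = u_i v_i] and [u_i = 0] too. *)
Lemma ker_one_zero i : d i = 0 -> (forall j, j != i -> d j != 0) ->
  forall j, u j = 0.
Proof.
move=> di dj; pose s := \sum_i u i * v i; have uk j : u j * d j + s * v j = 0 := u_ker j.
have s0 : s = 0.
  apply/eqP; have /eqP := uk i.
  by rewrite di mulr0 add0r mulf_eq0 (negbTE (v_neq0 i)) orbF.
have uj j : j != i -> u j = 0.
  move=> ji; apply/eqP; have /eqP := uk j.
  by rewrite s0 mul0r addr0 mulf_eq0 (negbTE (dj j ji)) orbF.
move=> j; have [->|/uj//] := eqVneq j i.
apply/eqP; move: s0; rewrite /s (bigD1 i)//= big1 => [|k /uj ->]; last first.
  by rewrite mul0r.
by rewrite addr0 => /eqP; rewrite mulf_eq0 (negbTE (v_neq0 i)) orbF.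
Qed.

(** The equations give [u_i = - s v_i / d_i], where [s] is the sum of the [u_k v_k]. So [s] is
    nonzero, and substituting into its definition and cancelling [s] gives the identity. *)
Lemma ker_no_zero : (forall j, d j != 0) -> (exists j, u j != 0) ->
  \sum_i v i ^+ 2 / d i = -1.
Proof.
move=> d0 [j uj]; pose s := \sum_i u i * v i; have uk j : u j * d j + s * v j = 0 := u_ker j.
have uE i : u i = - s * (v i / d i).
  apply: (mulIf (d0 i)); have /eqP := uk i; rewrite addr_eq0 => /eqP ->.
  by rewrite -mulrA divfK// mulNr.
have s0 : s != 0.
  by apply: contra uj => /eqP s0; rewrite uE s0 oppr0 mul0r.
apply: (mulfI s0); rewrite mulrN1 mulr_sumr -sumrN.
by apply: eq_bigr => i _; rewrite uE; field; rewrite d0.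
Qed.

End RankOnePerturbation.

(** * Flatness of the exponential and power forms *)

Section Homothetical.
Variables (R : realType) (n : nat) (J : 'I_n -> set R) (fs : 'I_n -> R -> R).
Hypothesis J_open : forall i, open (J i).
Hypothesis J_itv : forall i, is_interval (J i).
Hypothesis J_neq0 : forall i, J i !=set0.
Hypothesis fs_smooth : forall i, smooth_on (J i) (fs i).
Hypothesis fs_deriv_neq0 : forall i t, J i t -> derive1 (fs i) t != 0.
Implicit Types (x u : 'rV[R]_n) (i j k : 'I_n).

Definition set_coord x i (t : R) : 'rV[R]_n :=
  \row_k (if k == i then t else x 0 k).

Lemma set_coordE x i t k : set_coord x i t 0 k = if k == i then t else x 0 k.
Proof. by rewrite mxE. Qed.

Lemma box_set_coord x i t : box J x -> J i t -> box J (set_coord x i t).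
Proof. by move=> Jx Jt k; rewrite set_coordE; case: eqP => [->|]. Qed.

Lemma homothetical_set_coord (gs : 'I_n -> R -> R) x i t :
  homothetical gs (set_coord x i t) =
  gs i t * \prod_(k | k != i) gs k (x 0 k).
Proof.
rewrite /homothetical (bigD1 i)//= set_coordE eqxx; congr (_ * _).
by apply: eq_bigr => k /negbTE ki; rewrite set_coordE ki.
Qed.

Lemma graph_inj (f g : 'rV[R]_n -> R) x : graph f x = graph g x <-> f x = g x.
Proof.
split=> [|e]; last by rewrite /graph e.
by move=> /eq_row_mx[_ /matrixP/(_ 0 0)]; rewrite !mxE !mulr1n.
Qed.

Lemma point_in_box (P : 'I_n -> R -> Prop) :
  (forall i, exists2 t, J i t & P i t) ->
  exists2 x : 'rV[R]_n, box J x & forall i, P i (x 0 i).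
Proof.
move=> H; have /choice[p pP] : forall i, exists t, J i t /\ P i t.
  by move=> i; have [t] := H i; exists t.
by exists (\row_i p i) => i; rewrite mxE; have [] := pP i.
Qed.

Lemma fs_neq0_point i : exists2 t, J i t & fs i t != 0.
Proof.
apply: not_identically_zero => //; [exact: (@fs_smooth i 0)|exact: fs_deriv_neq0].
Qed.

(** Otherwise the product of [fs i] and its Wronskian would vanish on [J i], hence the Wronskian
    itself by [mul_eq0_on]. *)
Lemma log_wronskian_neq0_point i :
  ~ (forall t, J i t -> log_wronskian (fs i) t = 0) ->
  exists2 t, J i t & fs i t != 0 /\ log_wronskian (fs i) t != 0.
Proof.
move=> W0; apply: contrapT => H; apply: W0.
apply: (@mul_eq0_on _ (J i) (fs i)) => //.
- exact: (@fs_smooth i 0).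
- by move=> t Jt; exact: derivable_log_wronskian (@fs_smooth i) Jt.
- exact: fs_deriv_neq0.
move=> t Jt; apply/eqP; rewrite mulf_eq0; apply: contrapT => /negP.
by rewrite negb_or => /andP[? ?]; apply: H; exists t.
Qed.

(** Rows [i] and [j] of the Hessian are [li] and [lj] times the gradient, hence linearly
    dependent. *)
Lemma det_hessian_exp i j (li lj : R) x : box J x -> i != j -> lj != 0 ->
  (forall t, J i t -> derive1 (fs i) t = li * fs i t) ->
  (forall t, J j t -> derive1 (fs j) t = lj * fs j t) ->
  \det (hessian (homothetical fs) x) = 0.
Proof.
move=> Jx ij lj0 ei ej.
have row_exp l c k : (forall t, J l t -> derive1 (fs l) t = c * fs l t) ->
    hessian (homothetical fs) x l k
    = c * prod_derive1n fs (fun m => (m == k) : nat) x.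
  move=> el; rewrite (hessian_homothetical J_open fs_smooth)//.
  rewrite /prod_derive1n (bigD1 l)//= [in RHS](bigD1 l)//= mulrA eqxx.
  congr (_ * _); last by apply: eq_bigr => m /negbTE ->; rewrite addn0.
  case: (l == k); rewrite ?addn1 ?addn0/=; last exact: el.
  rewrite -[LHS]/(derive1 (derive1 (fs l)) (x 0 l)).
  rewrite (derive1_eq_on (@J_open l) (h := c \*: fs l))//.
  exact: is_derive1E (is_deriveZ c (@smooth_is_derive _ _ _ 0 _ (@fs_smooth l) (Jx l))).
apply/eqP/det0P; exists (lj *: delta_mx 0 i - li *: delta_mx 0 j).
  apply: contra lj0 => /eqP/rowP/(_ i); rewrite !mxE !eqxx (negbTE ij).
  by rewrite mulr1 mulr0 subr0 => ->.
apply/rowP => k; rewrite mulmxBl -!scalemxAl -!rowE !mxE.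
have := row_exp i li k ei; have := row_exp j lj k ej; rewrite !mxE => -> ->.
by ring.
Qed.

(** Euler's relation: row [i] times [x_i + be_i] has [k]-th entry [(al_i - [i = k])] times the
    [k]-th partial derivative, and these coefficients sum to [1 - 1 = 0]. So [x + be] is a kernel
    vector unless it is zero. *)
Lemma det_hessian_power (al be : 'I_n -> R) x : (0 < n)%N -> box J x ->
  \sum_i al i = 1 ->
  (forall i t, J i t -> (t + be i) * derive1 (fs i) t = al i * fs i t) ->
  \det (hessian (homothetical fs) x) = 0.
Proof.
move=> n0 Jx al1 e.
have e2 i t Jt := power_derive1n2 (@J_open i) (@fs_smooth i) (e i) (t := t) Jt.
have [i0 xi0|x0] := pickP (fun i => x 0 i + be i != 0).
  apply/eqP/det0P; exists (\row_i (x 0 i + be i)).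
    by apply: contra xi0 => /eqP/rowP/(_ i0); rewrite !mxE => ->.
  apply/rowP => k; rewrite !mxE.
  pose P := prod_derive1n fs (fun m => (m == k) : nat) x.
  rewrite (eq_bigr (fun i => (al i - (i == k)%:R) * P)) => [|i _].
    rewrite -mulr_suml sumrB al1 (bigD1 k)//= eqxx big1 => [|i /negbTE ->//].
    by rewrite addr0 subrr mul0r.
  rewrite mxE (hessian_homothetical J_open fs_smooth)//.
  rewrite /P /prod_derive1n (bigD1 i)//= [in RHS](bigD1 i)//= !mulrA eqxx.
  congr (_ * _); last by apply: eq_bigr => m /negbTE ->; rewrite addn0.
  by case: (i == k); rewrite ?addn1 ?addn0/= ?subr0; [exact: e2|exact: e].
(* Now [x = - be], where the second-order equation reads [0 = (al_i - 1) f_i']. *)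
have al_eq1 i : al i = 1.
  have /eqP := e2 i _ (Jx i); have /negbFE/eqP -> := x0 i.
  rewrite mul0r eq_sym mulf_eq0 (negbTE (fs_deriv_neq0 (Jx i))) orbF subr_eq0.
  by move=> /eqP.
have n1 : n = 1%N.
  move: al1; rewrite (eq_bigr (fun=> 1)) => [|i _]; last exact: al_eq1.
  by rewrite sumr_const card_ord => /eqP; rewrite -[1]/(1%:R) eqr_nat => /eqP.
have f''0 i t : J i t -> derive1n 2 (fs i) t = 0.
  apply: (@mul_eq0_on _ (J i) (shift (be i))) => //.
  - exact: (@fs_smooth i 2).
  - by move=> s _; rewrite (is_derive1E (is_derive_shift s 1 (be i))) oner_eq0.
  by move=> s Js; rewrite [LHS]e2// al_eq1 subrr mul0r.
(* Since [n = 1] and [f'' = 0], the Hessian is zero and any nonzero vector will do. *)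
apply/eqP/det0P; exists (const_mx 1).
  by apply/eqP => /rowP/(_ (Ordinal n0)); rewrite !mxE => /eqP; rewrite oner_eq0.
apply/rowP => k; rewrite !mxE big1// => i _.
have ik : i = k.
  apply/val_inj; have : (i < 1)%N by rewrite -[X in (_ < X)%N]n1.
  have : (k < 1)%N by rewrite -[X in (_ < X)%N]n1.
  by rewrite !ltnS !leqn0 => /eqP k0 /eqP i0; exact: etrans i0 (esym k0).
rewrite mxE mul1r; move: (hessian_homothetical J_open fs_smooth i k Jx).
rewrite mxE => ->; rewrite ik /prod_derive1n (bigD1 k)//= eqxx f''0//.
by rewrite mul0r.
Qed.

Lemma factor_proportional (gs : 'I_n -> R -> R) (ga : R) :
  (forall x, box J x -> homothetical fs x = ga * homothetical gs x) ->
  forall i, exists c, forall t, J i t -> fs i t = c * gs i t.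
Proof.
move=> fg i; have [p Jp p0] := point_in_box fs_neq0_point.
set K := \prod_(k | k != i) fs k (p 0 k).
have K0 : K != 0 by apply/prodf_neq0 => k _; exact: p0.
exists (ga * (\prod_(k | k != i) gs k (p 0 k)) / K) => t Jt.
apply: (mulIf K0); have := fg _ (box_set_coord Jp Jt).
by rewrite !homothetical_set_coord -/K => ->; field.
Qed.

Lemma derive1_exp_factor i (c l : R) :
  (forall t, J i t -> fs i t = c * expR (l * t)) ->
  forall t, J i t -> derive1 (fs i) t = l * fs i t.
Proof.
move=> fE t Jt; rewrite fE// (derive1_eq_on (@J_open i) (h := c \*: fun s => expR (l * s)))//.
have := is_deriveZ c (@is_derive1_comp _ expR (fun s => l * s) t _ _
  (is_derive_expR _) (is_derive_scale l t)).
by move=> /is_derive1E ->; rewrite /GRing.scale/=; ring.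
Qed.

Lemma exp_form_flat i j (ga li lj : R) : i != j -> lj != 0 ->
  (forall x, box J x -> homothetical fs x =
    ga * expR (li * x 0 i + lj * x 0 j)
    * \prod_(k < n | (k != i) && (k != j)) fs k (x 0 k)) ->
  forall x, box J x -> \det (hessian (homothetical fs) x) = 0.
Proof.
move=> ij lj0 fE x Jx.
(* The exponential of the sum is split between coordinates [i] and [j], which makes the right-hand
   side homothetical, so that factors can be compared one by one. *)
pose gs k := if k == i then fun t => expR (li * t) else
             if k == j then fun t => expR (lj * t) else fs k.
have ji : j != i by rewrite eq_sym.
have fg y : box J y -> homothetical fs y = ga * homothetical gs y.
  move=> Jy; rewrite fE// -mulrA; congr (_ * _).
  rewrite [RHS](bigD1 i)//= [X in _ = _ * X](bigD1 j)//= /gs !eqxx (negbTE ji).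
  rewrite expRD -mulrA; congr (_ * (_ * _)); apply: eq_bigr => k.
  by move=> /andP[/negbTE -> /negbTE ->].
have [ci] := factor_proportional fg i; have [cj] := factor_proportional fg j.
rewrite /gs !eqxx (negbTE ji) => fj fi.
apply: (det_hessian_exp (i := i) (j := j) (li := li) (lj := lj)) => //.
- exact: derive1_exp_factor fi.
- exact: derive1_exp_factor fj.
Qed.

Lemma power_form_flat (ga : R) (al be : 'I_n -> R) : (0 < n)%N ->
  \sum_i al i = 1 ->
  (forall x, box J x -> homothetical fs x =
    ga * \prod_i real_pow (x 0 i + be i) (al i)) ->
  forall x, box J x -> \det (hessian (homothetical fs) x) = 0.
Proof.
move=> n0 al1 fE x Jx.
apply: (det_hessian_power (al := al) (be := be)) => // i.
have [c fi] := factor_proportional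
  (gs := fun k t => real_pow (t + be k) (al k)) fE i.
exact: power_derive1 (@J_open i) (@fs_smooth i) fi.
Qed.

Lemma exp_form_of_two_flat i j : i != j ->
  (forall t, J i t -> log_wronskian (fs i) t = 0) ->
  (forall t, J j t -> log_wronskian (fs j) t = 0) ->
  exists ga li lj : R, [/\ ga != 0, li != 0, lj != 0 &
    forall x, box J x -> homothetical fs x =
      ga * expR (li * x 0 i + lj * x 0 j)
      * \prod_(k < n | (k != i) && (k != j)) fs k (x 0 k)].
Proof.
move=> ij Wi Wj; have flat k := exp_of_log_wronskian_eq0 (@J_itv k) (@J_neq0 k)
  (@fs_smooth k) (@fs_deriv_neq0 k).
have [ci [li [ci0 li0 fi]]] := flat i Wi.
have [cj [lj [cj0 lj0 fj]]] := flat j Wj.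
exists (ci * cj), li, lj; split => //; first exact: mulf_neq0.
move=> x Jx; rewrite /homothetical (bigD1 i)//= (bigD1 j)/=; last by rewrite eq_sym.
by rewrite fi// fj// expRD; ring.
Qed.

(** * From a degenerate Hessian to the two forms *)

Hypothesis det0 : forall x, box J x -> \det (hessian (homothetical fs) x) = 0.

(** At a point where all components and all Wronskians but the [i]-th are nonzero, [ker_one_zero]
    rules out the kernel vector of the Hessian. *)
Lemma not_one_flat i : (forall t, J i t -> log_wronskian (fs i) t = 0) ->
  ~ (forall j, j != i ->
     exists2 t, J j t & fs j t != 0 /\ log_wronskian (fs j) t != 0).
Proof.
move=> Wi Wj.
have [j|p Jp pP] := @point_in_box (fun j t => fs j t != 0 /\
    (j != i -> log_wronskian (fs j) t != 0)).
  have [->|ji] := eqVneq j i.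
    by have [t Jt ft] := fs_neq0_point i; exists t.
  by have [t Jt [ft Wt]] := Wj j ji; exists t.
have [u u0 uker] := hessian_kernel J_open fs_smooth Jp (fun k => (pP k).1) (det0 Jp).
move/negP: u0; apply; apply/eqP/rowP => k; rewrite mxE.
apply: (@ker_one_zero _ _ (fun j => log_wronskian (fs j) (p 0 j))
   (fun j => derive1 (fs j) (p 0 j)) (u 0) _ uker i) => [j||j ji].
- exact: fs_deriv_neq0.
- exact: Wi.
- exact: (pP j).2.
Qed.

Lemma sum_log_wronskian x : box J x -> (forall k, fs k (x 0 k) != 0) ->
  (forall k, log_wronskian (fs k) (x 0 k) != 0) ->
  \sum_k derive1 (fs k) (x 0 k) ^+ 2 / log_wronskian (fs k) (x 0 k) = -1.
Proof.
move=> Jx f0 W0.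
have [u u0 uker] := hessian_kernel J_open fs_smooth Jx f0 (det0 Jx).
apply: (@ker_no_zero _ _ _ _ (u 0) uker) => //.
by have /rV0Pn := u0.
Qed.

(** Moving only coordinate [i] of [p] to [t] leaves the other terms of [sum_log_wronskian]
    unchanged, and both sums are [-1]. Hence [f_i'^2 / W_i] agrees at [t] and at [p 0 i]. *)
Lemma log_wronskian_set_coord p i t : box J p ->
  (forall k, fs k (p 0 k) != 0) ->
  (forall k, log_wronskian (fs k) (p 0 k) != 0) -> J i t ->
  - (derive1 (fs i) (p 0 i) ^+ 2 / log_wronskian (fs i) (p 0 i))
    * log_wronskian (fs i) t = - derive1 (fs i) t ^+ 2.
Proof.
move=> Jp f0 W0; set a := - _; move=> Jt.
(* The difference of the two sides, as a differentiable function: the comparison works only where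
   [fs i] is nonzero, and [mul_eq0_on] extends [h = 0] to its zeros. *)
pose h := a \*: log_wronskian (fs i) + derive1n 1 (fs i) * derive1n 1 (fs i).
have hE s : h s = a * log_wronskian (fs i) s + derive1 (fs i) s ^+ 2.
  by rewrite expr2.
have dh s : J i s -> derivable h s 1.
  move=> Js; have d1 := @fs_smooth i 1 s Js; apply: derivableD.
    exact/derivableZ/(derivable_log_wronskian (@fs_smooth i) Js).
  exact: derivableM.
clearbody h; apply/eqP; rewrite -subr_eq0 opprK -hE; apply/eqP; move: t Jt.
apply: (@mul_eq0_on _ _ (fs i) h (@J_open i) (@fs_smooth i 0) dh (@fs_deriv_neq0 i)).
move=> t Jt; have [->|ft] := eqVneq (fs i t) 0; first by rewrite mul0r.
pose x := set_coord p i t.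
have Jx : box J x by exact: box_set_coord.
have x0 k : fs k (x 0 k) != 0 by rewrite set_coordE; have [->|] := eqVneq k i.
have Wx k : k != i -> log_wronskian (fs k) (x 0 k) != 0.
  by move=> /negbTE ki; rewrite set_coordE ki.
have xi : x 0 i = t by rewrite set_coordE eqxx.
(* If it vanished, it would be the only vanishing Wronskian at [x], against [ker_one_zero]. *)
have Wt : log_wronskian (fs i) t != 0.
  apply/eqP => Wt.
  have [u u0 uker] := hessian_kernel J_open fs_smooth Jx x0 (det0 Jx).
  move/negP: u0; apply; apply/eqP/rowP => k; rewrite mxE.
  apply: (@ker_one_zero _ _ (fun j => log_wronskian (fs j) (x 0 j))
   (fun j => derive1 (fs j) (x 0 j)) (u 0) _ uker i) => //.
  - by move=> j; exact: fs_deriv_neq0.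
  - by rewrite xi.
have := sum_log_wronskian Jx x0.
have Wx' k : log_wronskian (fs k) (x 0 k) != 0.
  by have [->|/Wx//] := eqVneq k i; rewrite xi.
move=> /(_ Wx'); rewrite -(sum_log_wronskian Jp f0 W0).
rewrite (bigD1 i)//= [RHS](bigD1 i)//= xi.
rewrite [X in _ + X = _ -> _](_ : _ = \sum_(k | k != i)
   derive1 (fs k) (p 0 k) ^+ 2 / log_wronskian (fs k) (p 0 k)); last first.
  by apply: eq_bigr => k /negbTE ki; rewrite set_coordE ki.
move=> /addIr E; apply/eqP; rewrite mulf_eq0 (negbTE ft) /=; apply/eqP.
by rewrite hE /a -E mulNr divfK// addNr.
Qed.

Lemma power_form_of_no_flat :
  (forall i, exists2 t, J i t & fs i t != 0 /\ log_wronskian (fs i) t != 0) ->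
  exists (ga : R) (al be : 'I_n -> R),
    [/\ ga != 0, (forall i, al i != 0), \sum_i al i = 1 &
      forall x, box J x -> homothetical fs x =
        ga * \prod_i real_pow (x 0 i + be i) (al i)].
Proof.
move=> /point_in_box[p Jp pP].
have f0 k := (pP k).1; have W0 k := (pP k).2.
(* These exponents sum to 1 by [sum_log_wronskian] at [p]; [log_wronskian_set_coord] says that they
   do not depend on the choice of [p]. *)
pose al i := - (derive1 (fs i) (p 0 i) ^+ 2 / log_wronskian (fs i) (p 0 i)).
have al0 i : al i != 0.
  rewrite oppr_eq0 mulf_neq0 ?invr_neq0 ?W0// sqrf_eq0.
  exact: fs_deriv_neq0 (Jp i).
have /choice[cb cbP] : forall i, exists cb : R * R, cb.1 != 0 /\
    forall t, J i t -> fs i t = cb.1 * real_pow (t + cb.2) (al i).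
  move=> i; have [c [b cbP]] := power_of_log_wronskian (@J_open i) (@J_itv i)
    (@J_neq0 i) (@fs_smooth i) (@fs_deriv_neq0 i) (al0 i)
    (fun t => log_wronskian_set_coord (i := i) (t := t) Jp f0 W0).
  by exists (c, b).
exists (\prod_i (cb i).1), al, (fun i => (cb i).2); split => //.
- by apply/prodf_neq0 => i _; exact: (cbP i).1.
- by rewrite sumrN (sum_log_wronskian Jp f0 W0) opprK.
move=> x Jx; rewrite -big_split/=; apply: eq_bigr => i _.
exact: (cbP i).2.
Qed.

End Homothetical.

Theorem theorem3p1 (R : realType) (n : nat) (J : 'I_n -> set R)
    (fs : 'I_n -> R -> R)
    (n_gt0 : (0 < n)%N)
    (J_open : forall i, open (J i))
    (J_itv : forall i, is_interval (J i))
    (J_neq0 : forall i, J i !=set0)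
    (fs_smooth : forall i, smooth_on (J i) (fs i))
    (fs_deriv_neq0 : forall i t, J i t -> derive1 (fs i) t != 0) :
  (forall x, box J x -> gauss_kronecker (homothetical fs) x = 0)
  <->
  (exists (i j : 'I_n) (gamma lambda_i lambda_j : R),
     [/\ i != j, gamma != 0, lambda_i != 0, lambda_j != 0 &
      forall x, box J x ->
        graph (homothetical fs) x =
        graph (fun y : 'rV[R]_n =>
                 gamma * expR (lambda_i * y 0 i + lambda_j * y 0 j)
                 * \prod_(k < n | (k != i) && (k != j)) fs k (y 0 k)) x])
  \/
  (exists (gamma : R) (alpha beta : 'I_n -> R),
     [/\ gamma != 0, (forall i, alpha i != 0), \sum_i alpha i = 1 &
      forall x, box J x ->
        graph (homothetical fs) x =
        graph (fun y : 'rV[R]_n =>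
                 gamma * \prod_i real_pow (y 0 i + beta i) (alpha i)) x]).
Proof.
have gkE x Jx := gauss_kronecker_eq0 J_open fs_smooth (x := x) Jx.
split=> [gk0|].
  have det0 x : box J x -> \det (hessian (homothetical fs) x) = 0.
    by move=> Jx; apply/gkE => //; exact: gk0.
  pose flat i := forall t, J i t -> log_wronskian (fs i) t = 0.
  have nflat i : ~ flat i ->
      exists2 t, J i t & fs i t != 0 /\ log_wronskian (fs i) t != 0.
    exact: log_wronskian_neq0_point.
  have [[i [j [ij fi fj]]]|no2] := pselect (exists i j, [/\ i != j, flat i & flat j]).
    left; have [ga [li [lj [ga0 li0 lj0 fE]]]] :=
      exp_form_of_two_flat J_itv J_neq0 fs_smooth fs_deriv_neq0 ij fi fj.
    by exists i, j, ga, li, lj; split => // x /fE fx; apply/graph_inj.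
  (* By [no2], a flat index would be the only one, which [not_one_flat] excludes. *)
  have no1 i : ~ flat i.
    move=> fi; apply: (not_one_flat J_open J_neq0 fs_smooth fs_deriv_neq0 det0 fi).
    by move=> j ji; apply: nflat => fj; apply: no2; exists j, i.
  right; have [ga [al [be [ga0 al0 al1 fE]]]] := power_form_of_no_flat
    J_open J_itv J_neq0 fs_smooth fs_deriv_neq0 det0 (fun i => nflat i (no1 i)).
  by exists ga, al, be; split => // x /fE fx; apply/graph_inj.
case=> [[i [j [ga [li [lj [ij ga0 li0 lj0 fE]]]]]]|[ga [al [be [ga0 al0 al1 fE]]]]]
  x Jx; apply/gkE => //.
- have fE' y (Jy : box J y) := (graph_inj _ _ _).1 (fE y Jy).
  exact: (exp_form_flat J_open J_neq0 fs_smooth fs_deriv_neq0 ij lj0 fE' Jx).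
- have fE' y (Jy : box J y) := (graph_inj _ _ _).1 (fE y Jy).
  exact: (power_form_flat J_open J_neq0 fs_smooth fs_deriv_neq0 n_gt0 al1 fE' Jx).
Qed.
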